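(* Let $n\ge 1$ and let $X$ be a finite pure $n$-dimensional simplicial complex with connected links. Assume that $X$ is $K$-regular in the following sense: every vertex $\{v\}\in X(0)$ is contained in exactly $K$ $n$-dimensional simplices of $X$. Assume that there is a constant $0<\lambda<1$ such that for every $\tau\in\bigcup_{k=-1}^{n-2}X(k)$ the spectrum of the weighted random walk operator $(M')^+_{\tau,0}$ on the one-skeleton of $X_\tau$ (with weights induced by the homogeneous weight function of $X$) is contained in $[-\lambda,\lambda]\cup\{1\}$. Then for all pairwise disjoint sets $U_0,\dots,U_n\subseteq X(0)$, $$\left| |X(U_0,\dots,U_n)|-\frac{n!\,K}{|X(0)|^n}|U_0||U_1|\cdots|U_n|\right|\le C_n\, n!\,\lambda K\min_{0\le i<j\le n}\sqrt{|U_i||U_j|},$$ where $$C_n=\sum_{k=0}^{n-1}\left((k+1)(k+2)^{n-k}-(k+1)^{n-k+1}\right).$$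
   Context: $X(k)$ denotes the set of simplices of $X$ with $k+1$ vertices, $X(-1)=\{\emptyset\}$; a vertex $v$ is identified with $\{v\}\in X(0)$. $X$ is pure $n$-dimensional if every simplex is contained in a simplex of $X(n)$. For $\tau\in X(k)$ the link $X_\tau$ is the complex with $\eta\in X_\tau(l)$ iff $\eta\in X(l)$ and $\tau\cup\eta\in X(k+l+1)$; $X_\emptyset=X$. ''Connected links'' means that for every $-1\le k\le n-2$ and every $\tau\in X(k)$ the one-skeleton of $X_\tau$ (the graph with vertices $X_\tau(0)$ and edges $X_\tau(1)$) is connected; in particular the one-skeleton of $X$ is connected. Homogeneous weight: for $-1\le k\le n$ and $\tau\in X(k)$, $m(\tau)=(n-k)!\,|\{\sigma\in X(n):\tau\subseteq\sigma\}|$. On the link, $m_\tau(\eta)=m(\tau\cup\eta)$. The weighted random walk operator $(M')^+_{\tau,0}$ acts on functions $\phi:X_\tau(0)\to\mathbb{R}$ by $$(M')^+_{\tau,0}\phi(v)=\sum_{u:\{u,v\}\in X_\tau(1)}\frac{m_\tau(\{u,v\})}{m_\tau(\{v\})}\phi(u).$$ For pairwise disjoint $U_0,\dots,U_n\subseteq X(0)$, $X(U_0,\dots,U_n)=\{\sigma\in X(n):|\sigma\cap U_i|=1\text{ for all }0\le i\le n\}$. *)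

(* Defs.v *)
From HB Require Import structures.
From mathcomp Require Import all_boot all_order all_algebra.
From mathcomp Require Import reals.

Set Implicit Arguments.
Unset Strict Implicit.
Unset Printing Implicit Defensive.

Import Order.TTheory GRing.Theory Num.Theory.
Local Open Scope ring_scope.

Section SimplicialComplex.
Variable V : finType.
Implicit Types (X : {set {set V}}) (s t tau eta sigma : {set V}).

(* The vertices of X are the v : V with [set v] \in X; V itself may be larger. *)
Definition simplicial_complex X : Prop :=
  set0 \in X /\ (forall s t, t \in X -> s \subset t -> s \in X).

Definition simplices X (k : nat) : {set {set V}} :=
  [set s in X | #|s| == k.+1].

Definition vertices X : {set V} := [set v | [set v] \in X].

Definition pure_dim (n : nat) X : Prop :=
  forall s, s \in X -> exists2 sigma, sigma \in simplices X n & s \subset sigma.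

(* The cardinality condition says that tau :|: eta has dimension k + l + 1 when
   tau and eta have dimensions k and l. *)
Definition link X tau : {set {set V}} :=
  [set eta in X | (tau :|: eta \in X) && (#|tau :|: eta| == #|tau| + #|eta|)%N].

Definition link_vertex X tau : finType := {v : V | v \in vertices (link X tau)}.

Definition link_edge X tau : rel (link_vertex X tau) :=
  fun u v => [set val u; val v] \in simplices (link X tau) 1.

(* Simplices of dimension -1 <= k <= n - 2 are those with fewer than n
   vertices. *)
Definition connected_links (n : nat) X : Prop :=
  forall tau, tau \in X -> (#|tau| < n)%N ->
  forall u v : link_vertex X tau, connect (@link_edge X tau) u v.

(* With k = #|tau| - 1, the factor (n - k)! is (n + 1 - #|tau|)!. *)
Definition weight (n : nat) X tau : nat :=
  ((n.+1 - #|tau|)`! * #|[set sigma in simplices X n | tau \subset sigma]|)%N.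

Definition link_weight (n : nat) X tau eta : nat := weight n X (tau :|: eta).

Definition regular_complex (n K : nat) X : Prop :=
  forall v, v \in vertices X ->
    #|[set sigma in simplices X n | v \in sigma]| = K.

Definition transversal_simplices (n : nat) X (U : 'I_n.+1 -> {set V}) :
    {set {set V}} :=
  [set sigma in simplices X n | [forall i, #|sigma :&: U i| == 1%N]].

Section RandomWalk.
Variable R : realType.

Definition random_walk (n : nat) X tau (phi : {ffun link_vertex X tau -> R^o}) :
    {ffun link_vertex X tau -> R^o} :=
  [ffun v => \sum_(u | link_edge u v)
     (link_weight n X tau [set val u; val v])%:R
       / (link_weight n X tau [set val v])%:R * phi u].

Lemma random_walk_is_linear (n : nat) X tau : linear (@random_walk n X tau).
Proof.
move=> a phi psi; apply/ffunP => v; rewrite !ffunE scaler_sumr -big_split /=.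
by apply: eq_bigr => u _; rewrite !ffunE mulrDr scalerAr.
Qed.

HB.instance Definition _ (n : nat) X tau :=
  GRing.isLinear.Build R {ffun link_vertex X tau -> R^o}
    {ffun link_vertex X tau -> R^o} *:%R (@random_walk n X tau)
    (@random_walk_is_linear n X tau).

Definition random_walk_spectrum (n : nat) X tau : pred R :=
  passmx.leigenvalue (linfun (@random_walk n X tau)).

Definition link_spectral_bound (n : nat) X (lambda : R) : Prop :=
  forall tau, tau \in X -> (#|tau| < n)%N ->
  forall a, random_walk_spectrum n X tau a -> - lambda <= a <= lambda \/ a = 1.

End RandomWalk.

End SimplicialComplex.

Definition mixing_constant (R : realType) (n : nat) : R :=
  \sum_(k < n) (k.+1%:R * k.+2%:R ^+ (n - k) - k.+1%:R ^+ (n - k).+1).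

(* For 1 <= n the seed of the minimum is itself the term of the pair (0, n). *)
Definition min_sqrt_card (R : realType) (V : finType) (n : nat)
    (U : 'I_n.+1 -> {set V}) : R :=
  \big[Order.min/Num.sqrt (#|U ord0|%:R * #|U ord_max|%:R)]_
     (p : 'I_n.+1 * 'I_n.+1 | (p.1 < p.2)%N)
       Num.sqrt (#|U p.1|%:R * #|U p.2|%:R).

(* Main.v *)
Require Import Defs.
From HB Require Import structures.
From mathcomp Require Import all_boot all_order all_algebra.
From mathcomp Require Import reals.
From mathcomp Require Import ring lra.
From mathcomp Require classical_sets.

(** Weight an ordered tuple of distinct vertices by the homogeneous weight of
its underlying simplex; summing out one coordinate of a [k+1]-tuple gives the
weight of the remaining [k]-tuple, so up to the normalization [m [::]] this is
an exchangeable law. Given [k] coordinates [s] of a [k+2]-tuple, the other two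
form a random edge of the link of [s], and the spectral hypothesis decouples
them up to [lambda]. Decoupling one vertex from the [k] others one coordinate
at a time bounds the covariance of [f(v)] and [h(v_1, ..., v_k)] by
[k * lambda] times their L2 norms. Splitting the indicators of the [U_i] off
one after the other costs [1 + ... + n <= C_n] times [lambda], and by
exchangeability any pair of sets may be put in the first two positions. *)

Set Implicit Arguments.
Unset Strict Implicit.
Unset Printing Implicit Defensive.

Import Order.TTheory GRing.Theory Num.Theory.
Local Open Scope ring_scope.

(** * Self-adjoint operators on weighted function spaces *)

Section WeightedSums.
Variable R : realType.

Lemma discriminant_le (a b c : R) : 0 <= a ->
  (forall t, 0 <= a * t ^+ 2 + 2 * b * t + c) -> b ^+ 2 <= a * c.
Proof.
move=> a_ge0 pos; have [a0|a_neq0] := eqVneq a 0.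
  have [->|b_neq0] := eqVneq b 0; first by rewrite a0 expr0n /= mul0r.
  (* With [a = 0] the polynomial is affine, and at this [t] it takes the value [-1]. *)
  have := pos (- (c + 1) / (2 * b)); rewrite a0 mul0r add0r.
  have -> : 2 * b * (- (c + 1) / (2 * b)) = - (c + 1) by field.
  lra.
(* The point where the quadratic is minimal. *)
have := pos (- b / a).
have -> : a * (- b / a) ^+ 2 + 2 * b * (- b / a) + c = (a * c - b ^+ 2) / a.
  by field.
by rewrite pmulr_lge0 ?subr_ge0// invr_gt0 lt0r a_neq0.
Qed.

Variable (I : finType).
Implicit Types (w f g : I -> R).

Definition dot w f g : R := \sum_i w i * f i * g i.

Lemma dotC w f g : dot w f g = dot w g f.
Proof. by apply: eq_bigr => i _; rewrite mulrAC. Qed.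

Lemma dot_ge0 w f : (forall i, 0 <= w i) -> 0 <= dot w f f.
Proof.
by move=> w0; apply: sumr_ge0 => i _; rewrite -mulrA -expr2 mulr_ge0 ?sqr_ge0.
Qed.

Lemma dot_cauchy_sqr w f g : (forall i, 0 <= w i) ->
  dot w f g ^+ 2 <= dot w f f * dot w g g.
Proof.
move=> w0; apply: discriminant_le => [|t]; first exact: dot_ge0.
suff <- : dot w (fun i => t * f i + g i) (fun i => t * f i + g i) =
    dot w f f * t ^+ 2 + 2 * dot w f g * t + dot w g g by exact: dot_ge0.
rewrite /dot mulr_sumr !mulr_suml -!big_split /=.
by apply: eq_bigr => i _; ring.
Qed.

Lemma dot_cauchy w f g : (forall i, 0 <= w i) ->
  `|dot w f g| <= Num.sqrt (dot w f f) * Num.sqrt (dot w g g).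
Proof.
move=> w0; rewrite -sqrtrM ?dot_ge0// -sqrtr_sqr ler_wsqrtr//.
exact: dot_cauchy_sqr.
Qed.

(** Cauchy-Schwarz for the counting measure, applied to square roots; it serves to add up the errors
    made in separate links. *)
Lemma sum_sqrt_cauchy f g : (forall i, 0 <= f i) -> (forall i, 0 <= g i) ->
  \sum_i Num.sqrt (f i) * Num.sqrt (g i)
    <= Num.sqrt (\sum_i f i) * Num.sqrt (\sum_i g i).
Proof.
move=> f0 g0.
have := @dot_cauchy (fun=> 1) (fun i => Num.sqrt (f i))
  (fun i => Num.sqrt (g i)) (fun=> ler01).
have E h : (forall i, 0 <= h i) -> \sum_i h i =
    dot (fun=> 1) (fun i => Num.sqrt (h i)) (fun i => Num.sqrt (h i)).
  by move=> h0; apply: eq_bigr => i _; rewrite mul1r -expr2 sqr_sqrtr.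
rewrite -!E// ger0_norm => [|]; first last.
  by apply: sumr_ge0 => i _; rewrite mul1r mulr_ge0 ?sqrtr_ge0.
by apply: le_trans; apply: ler_sum => i _; rewrite mul1r.
Qed.

End WeightedSums.

Section SelfAdjoint.
Import classical_sets.
Variables (R : realType) (T : finType) (w : T -> R).
Hypothesis w_gt0 : forall t, 0 < w t.
Local Notation E := {ffun T -> R^o}.
Implicit Types (f g : E) (A F : 'End(E)).

Let w_ge0 t : 0 <= w t := ltW (w_gt0 t).

(** Expand [f] in the indicators [d t]: each product [f s * f t] is at most [f s ^+ 2 + f t ^+ 2],
    and [w s * f s ^+ 2] is one summand of [dot w f f]. The constant is made strictly positive
    because it is inverted later. *)
Lemma lfun_bounded F :
  exists2 C, 0 < C & forall f, dot w (F f) (F f) <= C * dot w f f.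
Proof.
pose d t : E := [ffun s => (s == t)%:R].
pose N s t := dot w (F (d s)) (F (d t)).
pose C : R := \sum_s \sum_t `|N s t| * ((w s)^-1 + (w t)^-1).
have C0 : 0 <= C.
  apply: sumr_ge0 => s _; apply: sumr_ge0 => t _.
  by rewrite mulr_ge0// addr_ge0// invr_ge0.
exists (C + 1) => [|f]; first by rewrite ltr_wpDl.
have fE : f = \sum_t (f t : R) *: d t.
  apply/ffunP => s; rewrite sum_ffunE (bigD1 s)//= !ffunE eqxx big1 ?addr0.
    by rewrite /GRing.scale /= mulr1.
  by move=> t /negPf ts; rewrite !ffunE eq_sym ts /GRing.scale /= mulr0.
have FE x : F f x = \sum_t f t * F (d t) x.
  rewrite [in LHS]fE linear_sum sum_ffunE; apply: eq_bigr => t _.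
  by rewrite linearZ ffunE.
have -> : dot w (F f) (F f) = \sum_s \sum_t f s * f t * N s t.
  rewrite /dot; under eq_bigr => x _ do
    rewrite FE mulr_sumr.
  rewrite exchange_big; apply: eq_bigr => s _ /=.
  under eq_bigr => x _ do rewrite mulr_sumr mulr_suml.
  rewrite exchange_big; apply: eq_bigr => t _ /=.
  rewrite [N s t]dotC.
  by rewrite /N /dot mulr_sumr; apply: eq_bigr => x _; ring.
have sq s : (f s : R) ^+ 2 <= (w s)^-1 * dot w f f.
  rewrite ler_pdivlMl// /dot (bigD1 s)//= -mulrA -expr2 lerDl.
  by apply: sumr_ge0 => t _; rewrite -mulrA -expr2 mulr_ge0// sqr_ge0.
apply: (@le_trans _ _ (C * dot w f f)); last first.
  by rewrite ler_wpM2r ?dot_ge0// lerDl.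
rewrite /C mulr_suml; apply: ler_sum => s _.
rewrite mulr_suml; apply: ler_sum => t _.
apply: (le_trans (ler_norm _)); rewrite normrM mulrC -mulrA ler_wpM2l//.
have ss := sq s; have tt := sq t; rewrite mulrDl; apply/ler_normlP.
have := sqr_ge0 (f s - f t : R); have := sqr_ge0 (f s + f t : R).
have := sqr_ge0 (f s : R); have := sqr_ge0 (f t : R).
move: (dot _ _ _) ss tt => D; move: (f s : R) (f t : R) => x y.
by split; nra.
Qed.

(* If the optimal bound [r] of |A f|^2 / |f|^2 exceeded l^2, then
   M := r - A^2 = - (A - sqrt r) (A + sqrt r) would be injective, hence have a
   bounded inverse; together with |M f|^2 <= r <M f, f> (Cauchy-Schwarz for the
   positive form <M f, g>) this would improve the bound [r]. *)
Lemma selfadjoint_norm_le A (l : R) : 0 <= l ->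
  (forall f g, dot w (A f) g = dot w f (A g)) ->
  (forall a f, A f = a *: f -> f != 0 -> `|a| <= l) ->
  forall f, dot w (A f) (A f) <= l ^+ 2 * dot w f f.
Proof.
move=> l0 adjA specA.
pose S : set R :=
  [set c | 0 <= c /\ forall f, dot w (A f) (A f) <= c * dot w f f]%classic.
have S0 : (S !=set0)%classic.
  by have [C C0 bC] := lfun_bounded A; exists C; split; rewrite ?ltW.
have lbS : has_lbound S by exists 0 => c [].
pose r := inf S.
have r_ge0 : 0 <= r by apply: lb_le_inf => // c [].
have rS f : dot w (A f) (A f) <= r * dot w f f.
  have [f0|f0] := eqVneq (dot w f f) 0.
    by have [C [_ /(_ f)]] := S0; rewrite f0 !mulr0.
  have fp : 0 < dot w f f by rewrite lt0r f0 dot_ge0.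
  by rewrite -ler_pdivrMr//; apply: lb_le_inf => // c [_ /(_ f)]; rewrite ler_pdivrMr.
suff rl : r <= l ^+ 2.
  by move=> f; apply: le_trans (rS f) _; rewrite ler_wpM2r ?dot_ge0.
rewrite leNgt; apply/negP => lr.
have r_gt0 : 0 < r by apply: le_lt_trans lr; exact: sqr_ge0.
pose q := Num.sqrt r.
have q_gt0 : 0 < q by rewrite sqrtr_gt0.
have qq : q * q = r by rewrite -expr2 sqr_sqrtr.
have lq : l < q by rewrite -(ger0_norm l0) -sqrtr_sqr ltr_sqrt.
pose M : 'End(E) := r *: \1%VF - (A \o A)%VF.
have ME f : M f = r *: f - A (A f).
  by rewrite /M add_lfunE opp_lfunE scale_lfunE id_lfunE comp_lfunE.
(* If [A (A f) = r *: f], then either [A f + q *: f] is zero and [f] has eigenvalue [- q], or it is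
   itself an eigenvector for [q]. Both contradict [l < q]. *)
have kerM : lker M == 0%VS.
  rewrite -subv0; apply/subvP => f; rewrite memv_ker memv0 ME subr_eq0 => /eqP rf.
  apply: contraT => f0.
  have [g0|g0] := eqVneq (A f + q *: f) 0.
    have := specA (- q) f; rewrite normrN gtr0_norm// leNgt lq /=; apply=> //.
    by apply/eqP; rewrite scaleNr -addr_eq0 g0.
  have := specA q _ _ g0; rewrite gtr0_norm// leNgt lq /=; apply=> //.
  by rewrite linearD linearZ /= -rf scalerDr scalerA qq addrC.
have [C C0 bC] := lfun_bounded (M^-1)%VF.
have dotM f g : dot w (M f) g = r * dot w f g - dot w (A (A f)) g.
  rewrite /dot mulr_sumr -sumrB; apply: eq_bigr => t _.
  by rewrite ME !ffunE /GRing.scale /=; ring.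
have adjM f g : dot w (M f) g = dot w f (M g).
  by rewrite [RHS]dotC !dotM [dot w g f]dotC (adjA (A f)) (adjA f) [dot w f (A _)]dotC.
have q0 f : 0 <= dot w (M f) f by rewrite dotM adjA subr_ge0.
(* The discriminant of the form [<M g, g>] along [g = t f + M f] gives
   [|M f|^4 <= <M f, f> <M (M f), M f>], and the last factor is at most [r |M f|^2]; then cancel
   [|M f|^2]. *)
have Mle f : dot w (M f) (M f) <= r * dot w (M f) f.
  have [a0|a0] := eqVneq (dot w (M f) (M f)) 0; first by rewrite a0 mulr_ge0.
  have ap : 0 < dot w (M f) (M f) by rewrite lt0r a0 dot_ge0.
  rewrite -(ler_pM2r ap) -expr2 -mulrA mulrCA.
  apply: (@le_trans _ _ (dot w (M f) f * dot w (M (M f)) (M f))).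
    apply: discriminant_le => // t.
    have := q0 (t *: f + M f); congr (0 <= _).
    have exp (h k : E) : dot w (M (t *: h + k)) (t *: h + k) =
        dot w (M h) h * t ^+ 2 + t * (dot w (M h) k + dot w (M k) h) + dot w (M k) k.
      rewrite linearD linearZ mulr_suml mulrDr !mulr_sumr -!big_split.
      by apply: eq_bigr => s _; rewrite !ffunE /GRing.scale /=; ring.
    by rewrite exp [dot w (M (M f)) f]adjM; ring.
  apply: ler_wpM2l => //.
  by rewrite dotM adjA lerBlDr lerDl dot_ge0.
have Cr0 : 0 < C * r by rewrite mulr_gt0.
(* The chain [|f|^2 <= C |M f|^2 <= C r (r |f|^2 - |A f|^2)] lowers the bound by [1 / (C r)]. The
   maximum keeps it nonnegative, as membership in [S] demands. *)
have rCS : S (Num.max 0 (r - (C * r)^-1)).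
  split=> [|f]; first by rewrite le_max lexx.
  apply: (@le_trans _ _ ((r - (C * r)^-1) * dot w f f)).
    have := bC (M f); rewrite lker0_lfunK// => /le_trans.
    move=> /(_ _ (ler_wpM2l (ltW C0) (Mle f))).
    rewrite mulrA -ler_pdivrMl// dotM adjA mulrBl lerBrDl.
    by rewrite -lerBrDr addrC.
  by rewrite ler_wpM2r ?dot_ge0// le_max lexx orbT.
have := ge_inf lbS rCS; rewrite -/r le_max leNgt r_gt0 /=.
by rewrite leNgt gtrBl invr_gt0 Cr0.
Qed.
End SelfAdjoint.

(** * Mixing in a weighted expander graph *)

Section WeightedGraph.
Variables (R : realType) (T : finType).
Local Notation E := {ffun T -> R^o}.

(** For positive [w], the projection onto constants that is orthogonal for [dot w]. *)
Definition mean_proj (w : T -> R) (f : E) : E :=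
  [ffun=> (\sum_t w t * f t) / \sum_t w t].

Lemma mean_proj_is_linear w : linear (mean_proj w).
Proof.
move=> a f g; apply/ffunP => v; rewrite !ffunE /GRing.scale /= mulrA -mulrDl.
congr (_ / _); rewrite mulr_sumr -big_split; apply: eq_bigr => t _ /=.
by rewrite !ffunE /GRing.scale /=; ring.
Qed.

HB.instance Definition _ w :=
  GRing.isLinear.Build R E E *:%R (mean_proj w) (@mean_proj_is_linear w).

Lemma leigenvalueP (A : 'End(E)) a f :
  A f = a *: f -> f != 0 -> passmx.leigenvalue A a.
Proof.
move=> Af f0; rewrite /passmx.leigenvalue /passmx.leigenspace.
apply/eqP => k0; have : f \in (0%VS : {vspace E}).
  by rewrite -k0 memv_ker add_lfunE opp_lfunE scale_lfunE id_lfunE Af subrr.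
by rewrite memv0 (negPf f0).
Qed.

Variables (c : T -> T -> R) (e : rel T) (A : 'End(E)) (l : R).
Let w v : R := \sum_u c u v.
Hypothesis cC : forall u v, c u v = c v u.
Hypothesis c_ge0 : forall u v, 0 <= c u v.
Hypothesis w_gt0 : forall v, 0 < w v.
Hypothesis AE : forall f v, A f v = \sum_u c u v / w v * f u.
Hypothesis e_gt0 : forall u v, e u v -> 0 < c u v.
Hypothesis e_conn : forall u v, connect e u v.
Hypothesis l_ge0 : 0 <= l.
Hypothesis specA : forall a, passmx.leigenvalue A a -> - l <= a <= l \/ a = 1.

(** The degree [w v] cancels the denominator in [A]; the form that remains is symmetric because [c]
    is. *)
Let dotA (f : E) (g : T -> R) : dot w (A f) g = \sum_v \sum_u c u v * f u * g v.
Proof.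
apply: eq_bigr => v _; rewrite AE mulr_sumr mulr_suml; apply: eq_bigr => u _.
by rewrite mulrA mulrCA divff ?gt_eqF// mulr1.
Qed.

Let adjA (f g : E) : dot w (A f) g = dot w f (A g).
Proof.
rewrite [RHS]dotC !dotA exchange_big; apply: eq_bigr => u _.
by apply: eq_bigr => v _; rewrite cC mulrAC.
Qed.

Let fixed_const (f : E) : A f = f -> forall u v, f u = f v.
Proof.
move=> Af.
(* The Dirichlet energy <f - A f, f> of a fixed function vanishes. *)
have energy : \sum_v \sum_u c u v * (f u - f v) ^+ 2 = 0.
  have -> : \sum_v \sum_u c u v * (f u - f v) ^+ 2 =
      \sum_v \sum_u (c u v * f u ^+ 2) + \sum_v \sum_u (c u v * f v ^+ 2)
      - 2 * dot w (A f) f.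
    rewrite dotA mulr_sumr -big_split -sumrB; apply: eq_bigr => v _ /=.
    rewrite mulr_sumr -big_split -sumrB; apply: eq_bigr => u _ /=; ring.
  rewrite Af exchange_big /=.
  have -> : \sum_v \sum_u c u v * f v ^+ 2 = dot w f f.
    by apply: eq_bigr => v _; rewrite -mulr_suml -mulrA expr2.
  have -> : \sum_u \sum_v c u v * f u ^+ 2 = dot w f f.
    apply: eq_bigr => v _; rewrite -mulr_suml -mulrA expr2 /w.
    by congr (_ * _); apply: eq_bigr => u _.
  ring.
have t0 v u : 0 <= c u v * (f u - f v) ^+ 2 by rewrite mulr_ge0 ?sqr_ge0.
have edge u v : e u v -> f u = f v.
  move=> /e_gt0 cuv.
  have /eqP := energy; rewrite psumr_eq0 => [|x _]; last exact: sumr_ge0.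
  move=> /allP /(_ v (mem_index_enum v)) /=.
  rewrite psumr_eq0 => [|x _] //; move=> /allP /(_ u (mem_index_enum u)) /=.
  by rewrite mulf_eq0 gt_eqF//= sqrf_eq0 subr_eq0 => /eqP.
move=> u v; have /connectP[p pth ->] := e_conn u v.
elim: p u pth => //= x p IH u /andP[ux /IH <-]; exact: edge.
Qed.

(** Subtracting the mean from [A] removes the eigenvalue 1, so the difference [B] is self-adjoint
    with spectrum in [[-l, l]]. Its norm bound and Cauchy-Schwarz conclude. *)
Lemma expander_mixing (f g : T -> R) :
  `|\sum_v \sum_u c u v * f u * g v
     - (\sum_v w v * f v) * (\sum_v w v * g v) / \sum_v w v|
  <= l * (Num.sqrt (dot w f f) * Num.sqrt (dot w g g)).
Proof.
pose W := \sum_v w v.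
pose one : E := [ffun=> 1].
have dot1 (h : T -> R) : dot w h one = \sum_v w v * h v.
  by apply: eq_bigr => v _; rewrite ffunE mulr1.
pose B : 'End(E) := A - linfun (mean_proj w).
have BE (h : E) v : B h v = A h v - (\sum_v w v * h v) / W.
  by rewrite /B add_lfunE opp_lfunE lfunE !ffunE.
have dotB (h : E) (k : T -> R) : dot w (B h) k =
    dot w (A h) k - (\sum_v w v * h v) * (\sum_v w v * k v) / W.
  have -> : (\sum_v w v * h v) * (\sum_v w v * k v) / W =
      \sum_v w v * ((\sum_v w v * h v) / W) * k v.
    by rewrite mulrAC mulr_sumr; apply: eq_bigr => v _; rewrite mulrCA mulrA.
  by rewrite -sumrB; apply: eq_bigr => v _; rewrite BE; ring.
have adjB (h k : E) : dot w (B h) k = dot w h (B k).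
  by rewrite [RHS]dotC !dotB adjA [dot w h _]dotC [X in _ - X / _]mulrC.
(* [T] may be empty, hence the vertex as argument. *)
have W_neq0 (v : T) : W != 0.
  rewrite gt_eqF// /W (bigD1 v)//= ltr_wpDr//.
  by apply: sumr_ge0 => u _; exact: ltW.
have A1 : A one = one.
  apply/ffunP => v; rewrite AE ffunE.
  under eq_bigr do rewrite ffunE mulr1.
  by rewrite -mulr_suml; apply: divff; exact: lt0r_neq0 (w_gt0 v).
have B1 : B one = 0.
  apply/ffunP => v; rewrite BE A1 !ffunE.
  under eq_bigr do rewrite ffunE mulr1.
  by rewrite divff ?subrr// (W_neq0 v).
(* For [a != 0] the eigenvector is orthogonal to constants, so it is an eigenvector of [A] too.
   Eigenvalue 1 would make it constant by connectedness, hence zero. *)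
have specB a h : B h = a *: h -> h != 0 -> `|a| <= l.
  move=> Bh h0; have [->|a0] := eqVneq a 0; first by rewrite normr0.
  have h1 : \sum_v w v * h v = 0.
    have : dot w (B h) one = 0.
      by rewrite adjB B1; apply: big1 => v _; rewrite ffunE mulr0.
    rewrite Bh dot1 => s0; apply: (mulfI a0); rewrite mulr0 -[RHS]s0 mulr_sumr.
    by apply: eq_bigr => v _; rewrite !ffunE /GRing.scale /=; ring.
  have Ah : A h = a *: h.
    by apply/ffunP => v; rewrite -Bh BE h1 mul0r subr0.
  have [|a1] := specA (leigenvalueP Ah h0); first by rewrite ler_norml.
  case/eqP: h0; apply/ffunP => v; rewrite ffunE.
  have hc := fixed_const
    (etrans Ah (etrans (congr1 (fun x => x *: h) a1) (scale1r h))).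
  move: h1; under eq_bigr => u _ do rewrite (hc u v).
  by rewrite -mulr_suml => /eqP; rewrite mulf_eq0 (negPf (W_neq0 v)) => /eqP.
have w_ge0 v : 0 <= w v by exact: ltW.
pose f' : E := [ffun v => f v].
have f'E (k : T -> R) : dot w f' k = dot w f k.
  by apply: eq_bigr => v _; rewrite ffunE.
have := dotB f' g.
have -> : dot w (A f') g = \sum_v \sum_u c u v * f u * g v.
  by rewrite dotA; apply: eq_bigr => v _; apply: eq_bigr => u _; rewrite ffunE.
have -> : \sum_v w v * f' v = \sum_v w v * f v.
  by apply: eq_bigr => v _; rewrite ffunE.
move=> <-; apply: le_trans (dot_cauchy _ _ w_ge0) _.
rewrite mulrA ler_wpM2r ?sqrtr_ge0//.
have := selfadjoint_norm_le w_gt0 l_ge0 adjB specB f'.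
rewrite -ler_sqrt; last by rewrite mulr_ge0 ?sqr_ge0 ?dot_ge0.
by rewrite sqrtrM ?sqr_ge0// sqrtr_sqr ger0_norm// f'E dotC f'E.
Qed.

End WeightedGraph.

(** * Mixing for exchangeable weights on tuples *)

Lemma big_tuple_cons (R : nmodType) (T : finType) k (F : k.+1.-tuple T -> R) :
  \sum_t F t = \sum_x \sum_(s : k.-tuple T) F [tuple of x :: s].
Proof.
rewrite pair_big /=.
rewrite (reindex (fun p : T * k.-tuple T => [tuple of p.1 :: p.2])) //=.
exists (fun t => (thead t, [tuple of behead t])) => [[x s] _|t _] /=.
  by congr pair; apply: val_inj.
by rewrite -tuple_eta.
Qed.

Lemma big_tuple0 (R : nmodType) (T : finType) (F : 0.-tuple T -> R) :
  \sum_t F t = F [tuple].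
Proof.
rewrite (bigD1 [tuple]) //= big1 ?addr0// => t; case/negP; apply/eqP.
exact: tuple0.
Qed.

Section Swap.
Variables (R : realType) (V : finType) (n : nat) (m : seq V -> R) (l : R).
Hypothesis m_perm : forall s t, perm_eq s t -> m s = m t.
Hypothesis m_ge0 : forall s, 0 <= m s.
Hypothesis m_cons : forall s, (size s <= n)%N -> \sum_v m (v :: s) = m s.
Hypothesis l_ge0 : 0 <= l.
Hypothesis m_mixing : forall s, (size s < n)%N -> forall f g : V -> R,
  `|\sum_v \sum_u m [:: u, v & s] * f u * g v
     - (\sum_v m (v :: s) * f v) * (\sum_v m (v :: s) * g v) / m s|
  <= l * (Num.sqrt (dot (fun v => m (v :: s)) f f)
          * Num.sqrt (dot (fun v => m (v :: s)) g g)).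

Let Z := m [::].

(** This makes division by [m s = 0], which yields 0, harmless below. *)
Lemma m_cons0 s v : (size s <= n)%N -> m s = 0 -> m (v :: s) = 0.
Proof.
move=> sn ms; have /eqP := m_cons sn; rewrite ms psumr_eq0// => /allP.
by move=> /(_ v (mem_index_enum v)) /eqP.
Qed.

Lemma m_marginal k s : (size s + k <= n.+1)%N ->
  \sum_(t : k.-tuple V) m (s ++ t) = m s.
Proof.
elim: k s => [|k IH] s sk; first by rewrite big_tuple0 /= cats0.
rewrite big_tuple_cons.
under eq_bigr => x _.
  under eq_bigr => t _ do rewrite -cat_rcons.
  rewrite IH ?size_rcons; last by rewrite addSnnS.
  rewrite (m_perm (_ : perm_eq _ (x :: s))) ?perm_rcons//.
  over.
by rewrite m_cons//; rewrite addnS ltnS in sk; apply: leq_trans sk; rewrite leq_addr.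
Qed.

(** Induction on [k]: given the other coordinates [s], mixing in the link of [s] replaces
    [h (x :: s)] by its conditional mean over [x] at cost [l]. The mean depends on [k] coordinates
    only, and its norm is no larger, so the induction hypothesis adds [k * l]. *)
Lemma swap_mixing k (f : V -> R) (h : seq V -> R) : (k <= n)%N ->
  `|\sum_v \sum_(t : k.-tuple V) m (v :: t) * f v * h t
     - (\sum_v m [:: v] * f v) * (\sum_(t : k.-tuple V) m t * h t) / Z|
  <= k%:R * l * (Num.sqrt (dot (fun v => m [:: v]) f f)
                * Num.sqrt (dot (fun t : k.-tuple V => m t) h h)).
Proof.
elim: k h => [|k IH] h kn.
  rewrite !mul0r big_tuple0 /=.
  under eq_bigr do rewrite big_tuple0 /=.
  rewrite -mulr_suml; have [Z0|Z0] := eqVneq Z 0.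
    rewrite big1 ?mul0r ?subrr ?normr0// => v _.
    by rewrite m_cons0 ?mul0r.
  by rewrite mulrA mulrAC mulfK// subrr normr0.
pose S s := \sum_x m (x :: s) * h (x :: s).
(* Conditional expectation of [h (x :: s)] given [s]. *)
pose g s := S s / m s.
have mg (s : k.-tuple V) : m s * g s = S s.
  have [m0|m0] := eqVneq (m s) 0; last by rewrite mulrC divfK.
  rewrite m0 mul0r /S big1// => x _; rewrite m_cons0 ?mul0r//.
  by rewrite size_tuple ltnW.
have m_g : \sum_(t : k.+1.-tuple V) m t * h t = \sum_(s : k.-tuple V) m s * g s.
  rewrite big_tuple_cons exchange_big; apply: eq_bigr => s _.
  by rewrite mg.
(* Conditional expectation contracts the L2 norm: Cauchy-Schwarz against the constant 1 in each
   fibre. *)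
have gg : dot (fun t : k.-tuple V => m t) g g <=
    dot (fun t : k.+1.-tuple V => m t) h h.
  rewrite /dot big_tuple_cons exchange_big; apply: ler_sum => s _.
  rewrite mg /g mulrA.
  have := @dot_cauchy_sqr _ _ (fun x => m (x :: s)) (fun x => h (x :: s))
    (fun=> 1) (fun=> m_ge0 _).
  have -> : dot (fun x => m (x :: s)) (fun x => h (x :: s)) (fun=> 1) = S s.
    by apply: eq_bigr => x _; rewrite mulr1.
  have -> : dot (fun x => m (x :: s)) (fun=> 1) (fun=> 1) = m s.
    rewrite -[RHS]m_cons ?size_tuple 1?ltnW//.
    by apply: eq_bigr => x _; rewrite !mulr1.
  have := m_ge0 s; rewrite le_eqVlt => /orP[/eqP <- _|m0].
    rewrite invr0 mulr0; apply: sumr_ge0 => x _.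
    by rewrite -mulrA -expr2 mulr_ge0// sqr_ge0.
  by rewrite ler_pdivrMr// -expr2.
pose a (s : k.-tuple V) := dot (fun v => m (v :: s)) f f.
pose b (s : k.-tuple V) :=
  dot (fun x => m (x :: s)) (fun x => h (x :: s)) (fun x => h (x :: s)).
have sum_a : \sum_s a s = dot (fun v => m [:: v]) f f.
  rewrite exchange_big; apply: eq_bigr => v _ /=.
  rewrite -!mulr_suml -(@m_marginal k [:: v])//.
  by rewrite add1n ltnS ltnW.
have sum_b : \sum_s b s = dot (fun t : k.+1.-tuple V => m t) h h.
  by rewrite /dot big_tuple_cons exchange_big.
pose D (s : k.-tuple V) := \sum_x \sum_v m [:: v, x & s] * f v * h (x :: s).
have -> : \sum_v \sum_(t : k.+1.-tuple V) m (v :: t) * f v * h t = \sum_s D s.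
  under eq_bigr do rewrite big_tuple_cons /= exchange_big.
  rewrite exchange_big; apply: eq_bigr => s _ /=.
  by rewrite /D exchange_big.
(* Apply [m_mixing] for each [s], then sum by Cauchy-Schwarz; [a s] and [b s] are the squared norms
   conditioned on [s]. *)
have err : `|\sum_s D s - \sum_v \sum_(s : k.-tuple V) m (v :: s) * f v * g s|
    <= l * (Num.sqrt (dot (fun v => m [:: v]) f f)
            * Num.sqrt (dot (fun t : k.+1.-tuple V => m t) h h)).
  rewrite [X in _ - X]exchange_big -sumrB /=.
  apply: (le_trans (ler_norm_sum _ _ _)).
  apply: (@le_trans _ _ (\sum_s l * (Num.sqrt (a s) * Num.sqrt (b s)))).
    apply: ler_sum => s _; rewrite -mulr_suml mulrA.
    by apply: m_mixing; rewrite size_tuple.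
  rewrite -mulr_sumr ler_wpM2l// -sum_a -sum_b.
  by apply: sum_sqrt_cauchy => s; apply: dot_ge0.
rewrite m_g -(subrK (\sum_v \sum_(s : k.-tuple V) m (v :: s) * f v * g s) (\sum_s D s)).
rewrite -addrA; apply: (le_trans (ler_normD _ _)).
rewrite -natr1 [k%:R + 1]addrC mulrDl mul1r mulrDl lerD//.
apply: le_trans (IH g (ltnW kn)) _.
rewrite ler_wpM2l ?mulr_ge0 ?ler0n// ler_wpM2l ?sqrtr_ge0//.
exact: ler_wsqrtr.
Qed.

Definition set_weight (A : {set V}) : R := \sum_v m [:: v] * (v \in A)%:R.

Definition hits (L : seq {set V}) (s : seq V) : bool :=
  all2 (fun x (A : {set V}) => x \in A) s L.

Definition transversal_weight (L : seq {set V}) : R :=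
  \sum_(t : (size L).-tuple V) m t * (hits L t)%:R.

(* The junk value [m [::]] on the empty list makes [transversal_weight_mixing]
   hold for a single set too, with error zero. *)
Definition head_weight (L : seq {set V}) : R :=
  if L is A :: _ then set_weight A else Z.

Lemma set_weight_ge0 A : 0 <= set_weight A.
Proof. by apply: sumr_ge0 => v _; rewrite mulr_ge0. Qed.

Lemma set_weight_le A : set_weight A <= Z.
Proof.
rewrite /Z -m_cons//; apply: ler_sum => v _.
by case: (v \in A); rewrite ?mulr1 ?mulr0.
Qed.

Lemma transversal_weight_cons A L : transversal_weight (A :: L) =
  \sum_v \sum_(t : (size L).-tuple V) m (v :: t) * (v \in A)%:R * (hits L t)%:R.
Proof.
rewrite /transversal_weight big_tuple_cons; apply: eq_bigr => v _.
by apply: eq_bigr => t _; rewrite /hits /= -mulrA -natrM mulnb.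
Qed.

(** Drop every constraint except the first and sum out the free coordinates. *)
Lemma transversal_weight_le L : (size L <= n.+1)%N ->
  transversal_weight L <= head_weight L.
Proof.
case: L => [_|A L]; first by rewrite /transversal_weight big_tuple0 mulr1.
move=> sL; rewrite transversal_weight_cons; apply: ler_sum => v _.
rewrite -(@m_marginal (size L) [:: v])// mulr_suml; apply: ler_sum => t _.
by case: (hits L t); rewrite ?mulr1 ?mulr0 ?mulr_ge0.
Qed.

(** Induction on [L]: splitting off [A] costs [size L] times [l], and the remaining error for [L] is
    scaled by [set_weight A / Z]. *)
Lemma transversal_weight_mixing A L : (size L <= n)%N ->
  `|transversal_weight (A :: L)
    - set_weight A * \prod_(B <- L) set_weight B / Z ^+ size L|
  <= (\sum_(k < size L) k.+1%:R) * l
     * (Num.sqrt (set_weight A) * Num.sqrt (head_weight L)).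
Proof.
elim: L A => [|B L IH] A sL.
  rewrite big_nil big_ord0 !mul0r invr1 !mulr1 transversal_weight_cons /=.
  under eq_bigr do rewrite big_tuple0 mulr1.
  by rewrite subrr normr0.
set L1 := B :: L in sL *.
have Z_ge0 : 0 <= Z by exact: m_ge0.
have sqb (b : bool) (x : R) : x * b%:R * b%:R = x * b%:R.
  by case: b; rewrite ?mulr1 ?mulr0.
have := @swap_mixing (size L1) (fun v => (v \in A)%:R)
  (fun t => (hits L1 t)%:R) sL.
rewrite -transversal_weight_cons.
have -> : dot (fun v => m [:: v]) (fun v => (v \in A)%:R) (fun v => (v \in A)%:R)
    = set_weight A by apply: eq_bigr => v _; rewrite sqb.
have -> : dot (fun t : (size L1).-tuple V => m t) (fun t => (hits L1 t)%:R)
    (fun t => (hits L1 t)%:R) = transversal_weight L1.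
  by apply: eq_bigr => t _; rewrite sqb.
rewrite -/(set_weight A) -/(transversal_weight L1) => sw.
(* The squared norm of the indicator of hitting [L1] is its transversal weight, at most the weight
   of its head [B]. *)
have {sw} sw : `|transversal_weight (A :: L1)
    - set_weight A * transversal_weight L1 / Z|
    <= (size L1)%:R * l * (Num.sqrt (set_weight A) * Num.sqrt (set_weight B)).
  apply: le_trans sw _; rewrite ler_wpM2l ?mulr_ge0// ler_wpM2l ?sqrtr_ge0//.
  by apply: ler_wsqrtr; apply: (@transversal_weight_le L1); exact: leqW.
have ih := IH B (ltnW sL).
rewrite -(subrK (set_weight A * transversal_weight L1 / Z)
            (transversal_weight (A :: L1))) -addrA.
apply: (le_trans (ler_normD _ _)).
have -> : \sum_(k < size L1) k.+1%:R = (size L1)%:R + \sum_(k < size L) k.+1%:R :> R.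
  by rewrite big_ord_recr /= addrC.
rewrite mulrDl mulrDl lerD//.
set s := set_weight A in sw *.
have -> : s * transversal_weight L1 / Z - s * \prod_(C <- L1) set_weight C / Z ^+ size L1
    = s / Z * (transversal_weight L1 -
         set_weight B * \prod_(C <- L) set_weight C / Z ^+ size L).
  by rewrite big_cons [size L1]/= exprS invfM; ring.
have s0 : 0 <= s := set_weight_ge0 A.
have sZ : s <= Z := set_weight_le A.
rewrite normrM ger0_norm ?divr_ge0//.
apply: le_trans (ler_wpM2l (divr_ge0 s0 Z_ge0) ih) _.
rewrite mulrCA ler_wpM2l//.
  by rewrite mulr_ge0// sumr_ge0.
rewrite mulrCA mulrC ler_wpM2r ?sqrtr_ge0//.
(* The scaled error is absorbed by [s / Z * sqrt (head_weight L) <= s / sqrt Z <= sqrt s], since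
   both weights are at most [Z]. *)
have hL : Num.sqrt (head_weight L) <= Num.sqrt Z.
  apply: ler_wsqrtr; case: (L) => //= C _; exact: set_weight_le.
apply: le_trans (ler_wpM2l (divr_ge0 s0 Z_ge0) hL) _.
have [Z0|Z0] := eqVneq Z 0; first by rewrite Z0 invr0 mulr0 mul0r sqrtr_ge0.
have Zp : 0 < Num.sqrt Z by rewrite sqrtr_gt0 lt0r Z0.
have -> : s / Z * Num.sqrt Z = s / Num.sqrt Z.
  rewrite -[in s / Z](sqr_sqrtr Z_ge0); field; exact: lt0r_neq0.
rewrite ler_pdivrMr// -[X in X <= _](sqr_sqrtr s0) expr2 ler_wpM2l ?sqrtr_ge0//.
exact: ler_wsqrtr.
Qed.

End Swap.

(** * Weights of ordered simplices *)

Section Weights.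
Variables (V : finType) (X : {set {set V}}) (n : nat).
Implicit Types (A sigma tau : {set V}) (s t : seq V).

(** Double counting: a top simplex containing [A] has [n + 1 - #|A|] vertices outside [A], exactly
    the factor between the two factorials. *)
Lemma weight_sum A : (#|A| <= n)%N ->
  (\sum_(v | v \notin A) weight n X (v |: A) = weight n X A)%N.
Proof.
move=> An; pose C := [set sigma in simplices X n | A \subset sigma].
have wE v : v \notin A -> weight n X (v |: A) =
    ((n - #|A|)`! * \sum_(sigma in C) (v \in sigma))%N.
  move=> vA; rewrite /weight cardsU1 vA add1n subSS; congr (_ * _)%N.
  rewrite -sum1_card big_mkcond [RHS]big_mkcond /=; apply: eq_bigr => sigma _.
  by rewrite !inE subUset sub1set; case: (sigma \in X); case: (v \in sigma);
    case: (A \subset sigma); case: (#|sigma| == _).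
rewrite (eq_bigr _ wE) -big_distrr exchange_big /=.
rewrite /weight subSn// factS [(_.+1 * _)%N]mulnC -mulnA; congr (_ * _)%N.
rewrite mulnC -sum_nat_const; apply: eq_bigr => sigma.
rewrite !inE => /andP[/andP[_ /eqP cs] As].
rewrite -subSn// -cs -(cardsDS As) -sum1_card -big_mkcondr.
by apply: eq_bigl => v; rewrite !inE.
Qed.

Hypothesis complexX : simplicial_complex X.
Hypothesis pureX : pure_dim n X.

Lemma weight_gt0 A : (0 < weight n X A)%N = (A \in X).
Proof.
rewrite /weight muln_gt0 fact_gt0 /=; apply/card_gt0P/idP => [[sigma]|/pureX].
  rewrite !inE => /andP[/andP[sX _]]; exact: complexX.2.
by case=> sigma sn As; exists sigma; rewrite inE sn.
Qed.

Variable R : realType.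

(** Without the factor [uniq s], a tuple with repetitions would receive the weight of a smaller
    simplex. *)
Definition ordered_weight s : R :=
  (uniq s)%:R * (weight n X [set x in s])%:R.
Local Notation m := ordered_weight.

Lemma ordered_weight_perm s t : perm_eq s t -> m s = m t.
Proof.
move=> st; rewrite /m (perm_uniq st); congr (_ * (weight _ _ _)%:R).
by apply/setP => x; rewrite !inE (perm_mem st).
Qed.

Lemma ordered_weight_ge0 s : 0 <= m s.
Proof. by rewrite mulr_ge0. Qed.

Lemma card_uniq_set s : uniq s -> #|[set x in s]| = size s.
Proof. by move=> us; rewrite cardsE; apply/card_uniqP. Qed.

Lemma ordered_weight_cons s : (size s <= n)%N -> \sum_v m (v :: s) = m s.
Proof.
move=> sn; rewrite /m /=; have [us|_] := boolP (uniq s); last first.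
  by rewrite mul0r big1// => v _; rewrite andbF mul0r.
rewrite mul1r -weight_sum ?card_uniq_set// natr_sum [RHS]big_mkcond.
apply: eq_bigr => v _; rewrite inE andbT set_cons.
by case: (v \in s); rewrite /= ?mul0r ?mul1r.
Qed.

Lemma ordered_weight_gt0 s : (0 < m s) = uniq s && ([set x in s] \in X).
Proof.
rewrite /m -weight_gt0; case: (uniq s); last by rewrite mul0r ltxx.
by rewrite mul1r ltr0n.
Qed.

Lemma ordered_weight_eq0 s : ~~ (uniq s && ([set x in s] \in X)) -> m s = 0.
Proof.
by rewrite -ordered_weight_gt0 -leNgt => m0; apply/le_anti/andP; rewrite ordered_weight_ge0.
Qed.

Section Link.
Variables (s : seq V).
Hypotheses (us : uniq s) (sX : [set x in s] \in X) (sn : (size s < n)%N).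
Local Notation tau := [set x in s].

Lemma mem_link_vertices v : (v \in vertices (link X tau)) = (0 < m (v :: s)).
Proof.
rewrite ordered_weight_gt0 /= us andbT set_cons !inE.
rewrite setUC cardsU1 cards1 [(_ + #|tau|)%N]addnC eqn_add2l eqb1 inE.
case: (boolP (v |: tau \in X)) => [vX|_]; last by rewrite !andbF.
by rewrite (complexX.2 _ _ vX) ?subsetUl//= andbT.
Qed.

Lemma link_edgeE (u v : link_vertex X tau) :
  link_edge u v = (0 < m [:: val u, val v & s]).
Proof.
rewrite ordered_weight_gt0 /= us andbT.
have [] := (valP u, valP v); rewrite !mem_link_vertices !ordered_weight_gt0 /= us !andbT.
move=> /andP[us' _] /andP[vs' _].
rewrite !inE negb_or us' vs' !andbT /link_edge !inE.
have -> : [set x in [:: val u, val v & s]] = tau :|: [set val u; val v].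
  by apply/setP => x; rewrite !inE orbA orbC.
rewrite cards2; have [uv|uv] := eqVneq (val u) (val v) => /=.
  by rewrite andbF.
rewrite andbT; case: (boolP (tau :|: [set val u; val v] \in X)) => [tX|_]; last by rewrite andbF.
rewrite (complexX.2 _ _ tX) ?subsetUr//= cardsU cards2 uv.
have -> : tau :&: [set val u; val v] = set0.
  apply/setP => x; rewrite !inE; apply/negbTE/negP => /andP[xs].
  by case/orP => /eqP xE; [move: us'|move: vs']; rewrite -xE xs.
by rewrite cards0 subn0 eqxx.
Qed.

(** Passes between sums over all of [V], used for tuples, and sums over the link, where the walk
    acts. *)
Lemma sum_link (F : V -> R) :
  (forall v, m (v :: s) = 0 -> F v = 0) ->
  \sum_v F v = \sum_(v : link_vertex X tau) F (val v).
Proof.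
move=> F0; rewrite -big_sub [RHS]big_mkcond; apply: eq_bigr => v _.
rewrite mem_link_vertices; case: ifPn => //.
rewrite -leNgt => m0; apply: F0; apply/le_anti.
by rewrite m0 ordered_weight_ge0.
Qed.

End Link.

(** The link of [s] is a weighted graph with edge weights [m [:: u, v & s]] and degrees
    [m (v :: s)]; its walk is [random_walk], so [expander_mixing] applies. *)
Lemma ordered_weight_mixing (l : R) : 0 <= l ->
  connected_links n X -> link_spectral_bound n X l ->
  forall s, (size s < n)%N -> forall f g : V -> R,
  `|\sum_v \sum_u m [:: u, v & s] * f u * g v
     - (\sum_v m (v :: s) * f v) * (\sum_v m (v :: s) * g v) / m s|
  <= l * (Num.sqrt (dot (fun v => m (v :: s)) f f)
          * Num.sqrt (dot (fun v => m (v :: s)) g g)).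
Proof.
move=> l0 connX specX s sn f g.
have m0 t x : (size t <= n)%N -> m t = 0 -> m (x :: t) = 0.
  exact: m_cons0 ordered_weight_ge0 ordered_weight_cons t x.
(* If [s] does not list a simplex without repetition, all weights involved vanish. *)
have [/andP[us sX]|/ordered_weight_eq0 ms] := boolP (uniq s && ([set x in s] \in X)); last first.
  rewrite big1 => [|v _]; last first.
    by rewrite big1// => u _; rewrite m0 ?m0 ?mul0r// ltnW.
  by rewrite ms invr0 mulr0 subrr normr0 mulr_ge0 ?mulr_ge0 ?sqrtr_ge0.
pose tau := [set x in s].
have tn : (#|tau| < n)%N by rewrite card_uniq_set.
have swp u v : m [:: u, v & s] = m [:: v, u & s].
  by apply: ordered_weight_perm; rewrite (perm_catCA [:: u] [:: v]).
have mcons (v : V) : m (v :: s) = \sum_(u : link_vertex X tau) m [:: val u, v & s].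
  rewrite -ordered_weight_cons// (sum_link us) // => u mu.
  by rewrite swp m0.
have msE : m s = \sum_(v : link_vertex X tau) m (val v :: s).
  by rewrite -ordered_weight_cons ?(sum_link us)// ltnW.
pose L := link_vertex X tau.
have mL (v : L) : 0 < m (val v :: s) by rewrite -(mem_link_vertices us); exact: valP.
(* Pairs that are not edges have weight zero, so the sum over neighbours extends to the whole
   link. *)
have walkE (h : {ffun L -> R^o}) (v : L) : linfun (@random_walk V R n X tau) h v =
    \sum_u m [:: val u, val v & s]
            / (\sum_(u : L) m [:: val u, val v & s]) * h u.
  rewrite lfunE ffunE big_mkcond; apply: eq_bigr => u _.
  case: ifPn; rewrite (link_edgeE us); last first.
    rewrite -leNgt => muv.
    by rewrite (_ : m _ = 0) ?mul0r//; apply/le_anti; rewrite muv ordered_weight_ge0.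
  move=> euv; rewrite -mcons; move: (mL v) euv.
  rewrite /m !ordered_weight_gt0 => /andP[-> _] /andP[-> _].
  rewrite /link_weight !mul1r.
  have <- : tau :|: [set val u; val v] = [set x in [:: val u, val v & s]].
    by apply/setP => x; rewrite !inE orbC -orbA.
  have <- : tau :|: [set val v] = [set x in val v :: s].
    by apply/setP => x; rewrite !inE orbC.
  by [].
have := @expander_mixing R L (fun u v => m [:: val u, val v & s])
  (@link_edge V X tau) (linfun (@random_walk V R n X tau)) l
  (fun u v => swp (val u) (val v)) (fun u v => ordered_weight_ge0 _).
have wpos (v : L) : 0 < \sum_(u : L) m [:: val u, val v & s] by rewrite -mcons.
move=> /(_ wpos walkE).
have epos (u v : L) : link_edge u v -> 0 < m [:: val u, val v & s].
  by rewrite link_edgeE.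
move=> /(_ epos (connX tau sX tn) l0 (specX tau sX tn)).
move=> /(_ (fun v => f (val v)) (fun v => g (val v))).
have dE (h : V -> R) : dot (fun v => m (v :: s)) h h =
    dot (fun v : L => \sum_(u : L) m [:: val u, val v & s])
        (fun v => h (val v)) (fun v => h (val v)).
  rewrite /dot (sum_link us) => [|v ->]; last by rewrite !mul0r.
  by apply: eq_bigr => v _; rewrite mcons.
have sE (h : V -> R) : \sum_v m (v :: s) * h v =
    \sum_(v : L) (\sum_(u : L) m [:: val u, val v & s]) * h (val v).
  rewrite (sum_link us) => [|v ->]; last by rewrite mul0r.
  by apply: eq_bigr => v _; rewrite mcons.
have sn' : (size s < n.+1)%N by exact: ltnW.
rewrite !dE !sE; congr (`|_ - _ / _| <= _).
  rewrite (sum_link us) => [|v mv]; last first.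
    by rewrite big1// => u _; rewrite m0 ?mul0r.
  apply: eq_bigr => v _; rewrite (sum_link us) => [|u mu]; last first.
    by rewrite swp m0 ?mul0r.
  by [].
by rewrite msE; apply: eq_bigr => v _; rewrite mcons.
Qed.

End Weights.

(** * Transversal simplices *)

Lemma hits_tnth (V : finType) N (L : N.-tuple {set V}) (t : N.-tuple V) :
  hits L t = [forall i, tnth t i \in tnth L i].
Proof.
rewrite /hits; elim: N L t => [|N IH] L t.
  by rewrite (tuple0 L) (tuple0 t) /=; apply/esym/forallP => -[].
case/tupleP: L => A L; case/tupleP: t => x t /=; rewrite IH.
apply/andP/forallP => [[xA /forallP h] i|h].
  by case: (unliftP ord0 i) => [j ->|->]; rewrite ?tnthS ?tnth0.
split; first by have := h ord0; rewrite !tnth0.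
by apply/forallP => i; have := h (lift ord0 i); rewrite !tnthS.
Qed.

Section Counting.
Variables (R : realType) (V : finType) (X : {set {set V}}) (n : nat).
Variables (U : 'I_n.+1 -> {set V}) (idx : n.+1.-tuple 'I_n.+1).
Hypothesis disjU : forall i j, i != j -> [disjoint U i & U j].
Hypothesis uidx : uniq idx.

Let U_inj i j x : x \in U i -> x \in U j -> i = j.
Proof.
move=> xi xj; apply/eqP/negPn/negP => /disjU /pred0P /(_ x) /=.
by rewrite xi xj.
Qed.

Let idx_tnth i : exists k, i = tnth idx k.
Proof.
apply/tnthP; have /subset_cardP : #|idx| = #|'I_n.+1|.
  by rewrite (card_uniqP uidx) size_tuple card_ord.
by move=> /(_ (subset_predT _)) /(_ i); rewrite inE.
Qed.

(** A transversal simplex has exactly one ordering that visits the sets in the order [idx], and each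
    ordered top simplex has weight [0! * 1 = 1]. *)
Lemma transversal_weightE :
  transversal_weight (ordered_weight X n R) (map U idx)
    = #|transversal_simplices X U|%:R.
Proof.
pose D := [set t : n.+1.-tuple V |
  [&& uniq t, [set x in t] \in simplices X n & hits (map U idx) t]].
pose F (t : n.+1.-tuple V) := [set x in t].
have hitsE (t : n.+1.-tuple V) :
    reflect (forall k, tnth t k \in U (tnth idx k)) (hits (map U idx) t).
  rewrite (hits_tnth [tuple of map U idx]); apply: (iffP forallP) => h k.
    by have := h k; rewrite tnth_map.
  by rewrite tnth_map.
have -> : transversal_simplices X U = F @: D.
  apply/setP => sigma; apply/idP/imsetP => [|[t]].
    rewrite inE => /andP[sn /forallP s1].
    have /fin_all_exists[e eP] i : exists x, x \in sigma :&: U i.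
      by apply/set0Pn; rewrite -card_gt0 (eqP (s1 i)).
    have eU i : e i \in U i by have := eP i; rewrite inE => /andP[].
    (* Vertices chosen from disjoint sets are distinct, so these [n + 1] vertices exhaust
       [sigma]. *)
    have ut : uniq (map e idx).
      rewrite map_inj_uniq // => i j eij; apply: (@U_inj _ _ (e i)) => //.
      by rewrite eij.
    pose t := [tuple of map e idx].
    have tE : [set x in t] = sigma.
      apply/eqP; rewrite eqEcard; apply/andP; split.
        apply/subsetP => x; rewrite inE => /mapP[i _ ->].
        by have := eP i; rewrite inE => /andP[].
      rewrite cardsE (card_uniqP ut) size_tuple.
      by move: sn; rewrite inE => /andP[_ /eqP ->].
    exists t => //; rewrite inE ut tE sn /=; apply/hitsE => k.
    by rewrite tnth_map.
  rewrite inE => /and3P[ut tX /hitsE ht] ->; rewrite inE tX; apply/forallP => i.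
  have [k ->] := idx_tnth i; apply/cards1P; exists (tnth t k).
  apply/setP => x; rewrite !inE; apply/andP/eqP => [[/tnthP[j ->] xU]|->].
    congr tnth; apply/(tuple_uniqP _ uidx); exact: U_inj (ht j) xU.
  by split; [exact: mem_tnth|exact: ht].
rewrite card_in_imset; last first.
  move=> t t'; rewrite !inE => /and3P[ut _ /hitsE ht] /and3P[_ _ /hitsE ht'] tt'.
  apply: eq_from_tnth => k; have : tnth t k \in F t' by rewrite -tt' inE mem_tnth.
  rewrite inE => /tnthP[j tj]; rewrite tj; congr tnth.
  apply/(tuple_uniqP _ uidx); apply: (@U_inj _ _ (tnth t k)) => //.
  by rewrite tj.
rewrite -sum1_card natr_sum big_mkcond /transversal_weight size_map size_tuple.
apply: eq_bigr => t _; rewrite inE /ordered_weight.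
have [ut|_] := boolP (uniq t); last by rewrite !mul0r.
rewrite mul1r /weight card_uniq_set// size_tuple subnn mul1n.
have -> : #|[set sigma in simplices X n | [set x in t] \subset sigma]|
    = ([set x in t] \in simplices X n).
  have [tX|tX] := boolP (_ \in simplices X n).
    apply/eqP/cards1P; exists [set x in t]; apply/setP => sigma; rewrite !inE.
    apply/andP/eqP => [[/andP[_ /eqP cs] ts]|->]; last first.
      by move: tX; rewrite inE => ->.
    by apply/esym/eqP; rewrite eqEcard ts cs card_uniq_set// size_tuple /=.
  apply/eqP; rewrite cards_eq0; apply/eqP/setP => sigma; rewrite !inE.
  apply/negP => /andP[/andP[sX /eqP cs] ts]; case/negP: tX.
  suff -> : [set x in t] = sigma by rewrite inE sX cs eqxx.
  by apply/eqP; rewrite eqEcard ts cs card_uniq_set// size_tuple /=.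
by case: (_ \in simplices _ _); case: (hits _ _); rewrite ?mulr1 ?mulr0 ?mul0r.
Qed.

End Counting.

(** * Minimum, constant and final estimate *)

Lemma min_sqrt_card_attained (R : realType) (V : finType) (n : nat)
    (U : 'I_n.+1 -> {set V}) : (1 <= n)%N ->
  exists i j, i != j /\ min_sqrt_card R U = Num.sqrt (#|U i|%:R * #|U j|%:R).
Proof.
move=> n1; rewrite /min_sqrt_card.
elim/big_ind: _ => [|x y Hx Hy|[i j] /= ij].
- by exists ord0, ord_max; split; rewrite // -val_eqE /= eq_sym -lt0n.
- by case: leP.
- by exists i, j; split; rewrite // -val_eqE neq_ltn ij.
Qed.

(** The [k]-th term of the constant is [(k+1) ((k+2)^(n-k) - (k+1)^(n-k))], and the integer
    difference is at least 1 since [k < n]. *)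
Lemma triangle_le_mixing_constant (R : realType) n :
  \sum_(k < n) k.+1%:R <= mixing_constant R n.
Proof.
apply: ler_sum => k _; rewrite exprS -mulrBr ler_peMr ?ler0n//.
rewrite -!natrX -natrB ?leq_exp2r ?subn_gt0//; last first.
rewrite ler1n subn_gt0 ltn_exp2r// subn_gt0//.
Qed.

Theorem theorem1p1 (R : realType) (V : finType) (X : {set {set V}})
    (n K : nat) (lambda : R)
    (n_ge1 : (1 <= n)%N)
    (complexX : simplicial_complex X)
    (pureX : pure_dim n X)
    (connX : connected_links n X)
    (regX : regular_complex n K X)
    (lambda_gt0 : 0 < lambda) (lambda_lt1 : lambda < 1)
    (specX : link_spectral_bound n X lambda)
    (U : 'I_n.+1 -> {set V})
    (subU : forall i, U i \subset vertices X)
    (disjU : forall i j, i != j -> [disjoint U i & U j]) :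
  `| #|transversal_simplices X U|%:R
     - n`!%:R * K%:R / #|vertices X|%:R ^+ n * \prod_(i < n.+1) #|U i|%:R |
  <= mixing_constant R n * n`!%:R * lambda * K%:R * min_sqrt_card R U.
Proof.
have [i [j [ij ->]]] := min_sqrt_card_attained R U n_ge1.
pose m := ordered_weight X n R.
pose q : R := n`!%:R * K%:R.
have q_ge0 : 0 <= q by rewrite mulr_ge0.
(* Regularity makes the one-coordinate marginal [q] times the counting measure on vertices. *)
have m1 v : m [:: v] = q * (v \in vertices X)%:R.
  have vE : [set x in [:: v]] = [set v] by apply/setP => x; rewrite !inE.
  have [vX|vX] := boolP (v \in vertices X); last first.
    rewrite mulr0; apply: (ordered_weight_eq0 complexX pureX).
    by move: vX; rewrite inE vE.
  rewrite /m /ordered_weight /= mul1r mulr1 vE /weight cards1 subSS subn0 natrM.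
  rewrite /q -(regX v vX); congr (_ * _%:R); apply: eq_card => sigma.
  by rewrite !inE sub1set.
have swE k : set_weight m (U k) = q * #|U k|%:R.
  rewrite -sum1_card natr_sum mulr_sumr [RHS]big_mkcond; apply: eq_bigr => v _.
  rewrite m1; case: ifP => [vU|]; last by rewrite mulr0.
  by rewrite (subsetP (subU k) _ vU) !mulr1.
have m0 : m [::] = q * #|vertices X|%:R.
  rewrite -[LHS](@ordered_weight_cons V X n R)//.
  rewrite -sum1_card natr_sum mulr_sumr [RHS]big_mkcond; apply: eq_bigr => v _.
  by rewrite -/m m1; case: ifP => _; rewrite ?mulr1 ?mulr0.
(* Enumerate the indices starting with the minimizing pair, since the mixing error involves the
   first two sets only. *)
pose r := rem j (rem i (enum 'I_n.+1)).
have pidx : perm_eq (enum 'I_n.+1) [:: i, j & r].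
  rewrite (perm_trans (perm_to_rem (mem_enum _ i)))// perm_cons.
  apply: perm_to_rem; rewrite mem_rem_uniq ?enum_uniq// !inE mem_enum.
  by rewrite eq_sym ij.
have sidx : size [:: i, j & r] == n.+1.
  by rewrite -(perm_size pidx) size_enum_ord.
have uidx : uniq (Tuple sidx) by rewrite -(perm_uniq pidx) enum_uniq.
have sr : size (map U (j :: r)) = n.
  by apply/eqP; rewrite size_map; exact: sidx.
have := @transversal_weight_mixing R V n m lambda
  (@ordered_weight_perm V X n R) (@ordered_weight_ge0 V X n R)
  (@ordered_weight_cons V X n R) (ltW lambda_gt0)
  (ordered_weight_mixing complexX pureX (ltW lambda_gt0) connX specX)
  (U i) (map U (j :: r)).
rewrite sr => /(_ (leqnn _)).
have := @transversal_weightE R V X n U (Tuple sidx) disjU uidx.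
rewrite [map _ _]/= -/m => ->.
have -> : set_weight m (U i) * \prod_(B <- map U (j :: r)) set_weight m B
    = q ^+ n.+1 * \prod_(k < n.+1) #|U k|%:R.
  rewrite big_map -(big_cons _ _ i (j :: r) xpredT (fun k => set_weight m (U k))).
  rewrite -(perm_big _ pidx) big_enum /= (eq_bigr _ (fun k _ => swE k)) big_split /=.
  by rewrite prodr_const card_ord.
rewrite /= m0 !swE.
have -> : q ^+ n.+1 * \prod_(k < n.+1) #|U k|%:R / (q * #|vertices X|%:R) ^+ n
    = q / #|vertices X|%:R ^+ n * \prod_(k < n.+1) #|U k|%:R.
  (* For [q = 0] both sides vanish; otherwise [q ^+ n] cancels. *)
  have [->|q0] := eqVneq q 0; first by rewrite exprS !mul0r.
  have qn0 : q ^+ n != 0 by rewrite expf_neq0.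
  rewrite [(q * _) ^+ n]exprMn invfM exprS; move: (q ^+ n) qn0 (_ ^+ n)^-1 => x x0 z.
  by move: (\prod_(_ < _) _) => y; field.
move=> /le_trans; apply.
have -> : Num.sqrt (q * #|U i|%:R) * Num.sqrt (q * #|U j|%:R)
    = q * Num.sqrt (#|U i|%:R * #|U j|%:R).
  by move: (q) q_ge0 => x x0; rewrite !sqrtrM ?ler0n// mulrACA -expr2 sqr_sqrtr.
have -> : mixing_constant R n * n`!%:R * lambda * K%:R * Num.sqrt (#|U i|%:R * #|U j|%:R)
    = mixing_constant R n * (lambda * (q * Num.sqrt (#|U i|%:R * #|U j|%:R))).
  by rewrite /q; ring.
rewrite -mulrA ler_wpM2r ?triangle_le_mixing_constant//.
exact: mulr_ge0 (ltW lambda_gt0) (mulr_ge0 q_ge0 (sqrtr_ge0 _)).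
Qed.
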